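(* For any $\chi\ge3$ and $L>\mu>0$ there exist a number of nodes $n$ with $\mathcal V=\{1,\dots,n\}$, a sequence of graphs $\{\mathcal G^q=(\mathcal V,\mathcal E^q)\}_{q=0}^\infty$, a corresponding sequence of gossip matrices $\{\mathbf W(q)\}_{q=0}^\infty\subset\mathbb R^{n\times n}$ (satisfying properties 1–4 of the context with this $\chi$), and $\mu$-strongly convex and $L$-smooth functions $f_i:\ell_2\to\mathbb R$, $i\in\mathcal V$, such that for any first-order decentralized algorithm, the number of decentralized communication rounds needed to find an $\epsilon$-accurate solution of $\min_{x\in\ell_2}\sum_{i=1}^nf_i(x)$ is lower bounded by $$\Omega\left(\chi\sqrt{L/\mu}\,\log\frac1\epsilon\right).$$
   Context: **Space.** $\ell_2=\{x=(x_{[l]})_{l=1}^\infty:\sum_{l}x_{[l]}^2<\infty\}$ with its standard norm and inner product; it plays the role of $\mathbb R^d$ with $d\to\infty$. **Functions.** $f$ is $L$-smooth and $\mu$-strongly convex if for all $x,y$: $f(y)+\langle\nabla f(y),x-y\rangle+\frac\mu2\|x-y\|^2\le f(x)\le f(y)+\langle\nabla f(y),x-y\rangle+\frac L2\|x-y\|^2$. $f_i^*(x)=\sup_y[\langle x,y\rangle-f_i(y)]$ is the Fenchel conjugate. **Network.** At communication round $q\in\{0,1,2,\dots\}$ the nodes are connected by a graph $\mathcal G^q=(\mathcal V,\mathcal E^q)$, $\mathcal E^q\subset\{(i,j)\in\mathcal V\times\mathcal V:i\ne j\}$; $\mathcal N_i^q=\{j\in\mathcal V:(i,j)\in\mathcal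 E^q\}$. **Gossip matrices.** For each $q$: (1) $\mathbf W(q)_{i,j}\ne0$ iff $(i,j)\in\mathcal E^q$ or $i=j$; (2) $\ker\mathbf W(q)\supset\{x\in\mathbb R^n:x_1=\dots=x_n\}$; (3) $\mathrm{range}\,\mathbf W(q)\subset\{x\in\mathbb R^n:\sum_i x_i=0\}$; (4) $\|\mathbf W(q)x-x\|^2\le(1-\chi^{-1})\|x\|^2$ for all $x\in\mathbb R^n$ with $\sum_i x_i=0$. **First-order decentralized algorithms.** At each time step $k\in\{0,1,2,\dots\}$ node $i$ maintains a finite local memory $\mathcal H_i(k)\subset\ell_2$, with $\mathcal H_i(0)=\{0\}$. At each time step $k$ the algorithm performs either a local computation round or a decentralized communication round. If a local computation round is performed at step $k$, then for all $i\in\mathcal V$, $\mathcal H_i(k+1)\subset\mathrm{Span}(\{x,\nabla f_i(x),\nabla f_i^*(x):x\in\mathcal H_i(k)\})$. If a communication round is performed at step $k$, then for all $i\in\mathcal V$, $\mathcal H_i(k+1)\subset\mathrm{Span}(\bigcup_{j\in\mathcal N_i^q\cup\{i\}}\mathcal H_j(k))$, where $q$ is the index of this communication round (the first one has index $q=0$, the next $q=1$, etc.). At time step $k$ each node $i$ specifies an output $x_i^o(k)\in\mathcal H_i(k)$. **Accuracy and asymptotic notation.** An $\epsilon$-accurate solution is found at time step $k$ if $\|x_i^o(k)-x^*\|^2\le\epsilon$ for all $i\in\mathcal V$, where $x^*$ is the unique minimizer; the number of communication rounds counted is the number performed before such a step $k$. $\Omega(\cdot)$ is asymptotic in $\epsilon\to0$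 and large $L/\mu$: there is a universal constant $c>0$ such that the count is at least $c$ times the displayed expression whenever $L/\mu$ exceeds a universal constant and $\epsilon>0$ is below a threshold that may depend on $\chi,L,\mu$ (but not on the algorithm). The graphs, matrices and functions do not depend on $\epsilon$. *)

(* Defs.v *)
(* MathComp-Analysis; the reals are an arbitrary R : realType. *)
From HB Require Import structures.
From mathcomp Require Import all_boot all_order all_algebra.
From mathcomp Require Import all_classical all_reals all_analysis.
From mathcomp Require Import ring.

Set Implicit Arguments.
Unset Strict Implicit.
Unset Printing Implicit Defensive.

Import Order.TTheory GRing.Theory Num.Theory.
Import numFieldNormedType.Exports.

Local Open Scope classical_set_scope.
Local Open Scope ring_scope.

Section SquareSummable.
Context {R : realType}.

Definition square_summable : {pred nat -> R} :=
  fun x => `[< cvgn (series (fun l => x l ^+ 2)) >].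

Lemma square_summableM (x y : nat -> R) :
  x \in square_summable -> y \in square_summable ->
  cvgn (series (fun l => x l * y l)).
Proof.
move=> /asboolP cx /asboolP cy; apply: (@normed_cvg _ R^o).
apply: series_le_cvg (is_cvg_seriesD cx cy) => l //=.
  by rewrite addr_ge0 ?sqr_ge0.
rewrite /GRing.add /= -(real_normK (num_real (x l))).
rewrite -(real_normK (num_real (y l))) normrM.
have := sqr_ge0 (`|x l| - `|y l|); rewrite sqrrB addrAC subr_ge0.
apply: le_trans; rewrite mulr2n lerDl.
exact: mulr_ge0.
Qed.

Lemma square_summable_submod_closed : submod_closed square_summable.
Proof.
split=> [|a x y xs ys]; apply/asboolP.
  have -> : series (fun l => (0 : nat -> R) l ^+ 2) = cst 0.
    by apply/funext => n; rewrite /series /= big1 // => i _; rewrite expr0n.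
  exact: is_cvg_cst.
have /asboolP cx := xs; have /asboolP cy := ys.
have cxy := square_summableM xs ys.
have -> : (fun l => (a *: x + y) l ^+ 2) =
    (a ^+ 2) *: (fun l => x l ^+ 2) + (a *+ 2) *: (fun l => x l * y l)
    + (fun l => y l ^+ 2).
  apply/funext => l; change ((a * x l + y l) ^+ 2 =
    a ^+ 2 * x l ^+ 2 + a *+ 2 * (x l * y l) + y l ^+ 2).
  by rewrite !expr2; ring.
by apply: is_cvg_seriesD => //; apply: is_cvg_seriesD; exact: is_cvg_seriesZ.
Qed.

HB.instance Definition _ := GRing.isSubmodClosed.Build R (nat -> R)
  square_summable square_summable_submod_closed.

End SquareSummable.

(* Coordinates are numbered from 0: [x l] is the (l+1)-st coordinate of x. *)
Record ell2 (R : realType) := Ell2 {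
  ell2_seq :> nat -> R ;
  ell2P : ell2_seq \in square_summable }.

HB.instance Definition _ (R : realType) := [isSub of ell2 R for @ell2_seq R].
HB.instance Definition _ (R : realType) := [Choice of ell2 R by <:].
HB.instance Definition _ (R : realType) :=
  [SubChoice_isSubLmodule of ell2 R by <:].

Section Ell2.
Context {R : realType}.
Implicit Types (x y z : ell2 R) (a : R).

Definition inner x y : R := limn (series (fun l => x l * y l)).

Definition ell2_norm x : R := Num.sqrt (inner x x).

Lemma inner_cvg x y : cvgn (series (fun l => x l * y l)).
Proof. by apply: square_summableM; exact: ell2P. Qed.

Lemma innerC x y : inner x y = inner y x.
Proof.
rewrite /inner; congr (limn (series _)).
by apply/funext => l; rewrite mulrC.
Qed.

Lemma innerDl x y z : inner (x + y) z = inner x z + inner y z.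
Proof.
rewrite /inner -lim_seriesD; try exact: inner_cvg.
congr (limn (series _)); apply/funext => l /=.
by rewrite [LHS]mulrDl.
Qed.

Lemma innerZl a x y : inner (a *: x) y = a * inner x y.
Proof.
rewrite /inner -[RHS]lim_seriesZ; last exact: inner_cvg.
congr (limn (series _)); apply/funext => l /=.
exact: esym (mulrA _ _ _).
Qed.

Lemma innerDr x y z : inner z (x + y) = inner z x + inner z y.
Proof. by rewrite innerC innerDl !(innerC z). Qed.

Lemma innerZr a x y : inner x (a *: y) = a * inner x y.
Proof. by rewrite innerC innerZl innerC. Qed.

Lemma inner_ge_coord x l : x l ^+ 2 <= inner x x.
Proof.
have nd : nondecreasing_seq (series (fun l => x l * x l)).
  by apply: nondecreasing_series => i _ _; rewrite -expr2 sqr_ge0.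
apply: le_trans (nondecreasing_cvgn_le nd (@inner_cvg x x) l.+1).
rewrite /series /= big_nat_recr //= -expr2 lerDr.
by apply: sumr_ge0 => i _; rewrite -expr2 sqr_ge0.
Qed.

Lemma inner_ge0 x : 0 <= inner x x.
Proof. exact: le_trans (sqr_ge0 _) (inner_ge_coord x 0). Qed.

Lemma inner_eq0 x : inner x x = 0 -> x = 0.
Proof.
move=> x0; apply: val_inj; apply/funext => l /=.
apply/eqP; rewrite -sqrf_eq0 eq_le sqr_ge0 andbT -x0.
exact: inner_ge_coord.
Qed.

Lemma ell2_norm_sqr x : ell2_norm x ^+ 2 = inner x x.
Proof. by rewrite sqr_sqrtr // inner_ge0. Qed.

Lemma ell2_norm0_eq0 x : ell2_norm x = 0 -> x = 0.
Proof. by move=> x0; apply: inner_eq0; rewrite -ell2_norm_sqr x0 expr0n. Qed.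

Lemma ell2_normZ a x : ell2_norm (a *: x) = `|a| * ell2_norm x.
Proof.
by rewrite /ell2_norm innerZl innerZr mulrA -expr2 sqrtrM ?sqr_ge0 // sqrtr_sqr.
Qed.

Lemma inner_le_norm x y : inner x y <= ell2_norm x * ell2_norm y.
Proof.
have nx : 0 <= ell2_norm x by exact: sqrtr_ge0.
have ny : 0 <= ell2_norm y by exact: sqrtr_ge0.
have [x0|x0] := eqVneq (ell2_norm x) 0.
  rewrite x0 mul0r (ell2_norm0_eq0 x0) -(scale0r (0 : ell2 R)) innerZl.
  by rewrite mul0r.
have [y0|y0] := eqVneq (ell2_norm y) 0.
  rewrite y0 mulr0 (ell2_norm0_eq0 y0) -(scale0r (0 : ell2 R)) innerZr.
  by rewrite mul0r.
have p0 : 0 < ell2_norm x * ell2_norm y.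
  by rewrite mulr_gt0 // lt_neqAle eq_sym ?x0 ?y0.
have := inner_ge0 (ell2_norm y *: x + (- ell2_norm x) *: y).
rewrite innerDl !innerDr !innerZl !innerZr -!ell2_norm_sqr (innerC y x).
set s := ell2_norm x in p0 *; set t := ell2_norm y in p0 *.
set u := inner x y => h.
have {h} : 0 <= (s * t) * (2 * (s * t - u)).
  apply: le_trans h _; rewrite le_eqVlt; apply/orP; left; apply/eqP.
  by rewrite !expr2; ring.
by rewrite pmulr_rge0 // pmulr_rge0 // subr_ge0.
Qed.

Lemma ell2_normD x y : ell2_norm (x + y) <= ell2_norm x + ell2_norm y.
Proof.
have nx : 0 <= ell2_norm x by exact: sqrtr_ge0.
have ny : 0 <= ell2_norm y by exact: sqrtr_ge0.
rewrite -(@ler_pXn2r _ 2) ?nnegrE ?addr_ge0 ?sqrtr_ge0 //.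
rewrite ell2_norm_sqr innerDl !innerDr (innerC y x) -!ell2_norm_sqr sqrrD.
rewrite addrA lerD2r -addrA lerD2l mulr2n.
by apply: lerD; exact: inner_le_norm.
Qed.

End Ell2.

HB.instance Definition _ (R : realType) := Lmodule_isNormed.Build R (ell2 R)
  (@ell2_normD R) (@ell2_normZ R) (@ell2_norm0_eq0 R).

Lemma ell2_normE (R : realType) (x : ell2 R) :
  `|x| = Num.sqrt (inner x x).
Proof. by []. Qed.

Section Functions.
Context {R : realType}.
Implicit Types (f : ell2 R -> R) (x g : ell2 R).

(* g is the Riesz representative of the Frechet differential of f at x. *)
Definition is_gradient f x g : Prop :=
  is_diff x (f : ell2 R -> R^o) (inner g : ell2 R -> R^o).

(* Takes the junk value 0 where f has no gradient. *)
Definition grad f x : ell2 R := xget 0 [set g | is_gradient f x g].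

Definition smooth_strongly_convex (mu L : R) f : Prop :=
  (forall y, is_gradient f y (grad f y)) /\
  forall x y,
    f y + inner (grad f y) (x - y) + mu / 2 * `|x - y| ^+ 2 <= f x
      <= f y + inner (grad f y) (x - y) + L / 2 * `|x - y| ^+ 2.

(* A real-valued supremum: it is the true one whenever the set is bounded
   above, in particular at every x when f is strongly convex. *)
Definition conjugate f x : R := sup [set inner x y - f y | y in setT].

Definition is_minimizer f x : Prop := forall y, f x <= f y.

End Functions.

Definition lin_span (R : realType) (V : lmodType R) (A : set V) : set V :=
  [set v | exists (m : nat) (a : 'I_m -> R) (x : 'I_m -> V),
     (forall i, A (x i)) /\ v = \sum_(i < m) a i *: x i].

(* E i j says that (i, j) is an edge; E need not be symmetric. *)
Definition gossip_matrix (R : realType) (chi : R) (n : nat)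
    (E : rel 'I_n) (W : 'M[R]_n) : Prop :=
  [/\ forall i j, (W i j != 0) = E i j || (i == j),
      forall x : 'cV[R]_n, (forall i j, x i 0 = x j 0) -> W *m x = 0,
      forall x : 'cV[R]_n, \sum_i (W *m x) i 0 = 0
    & forall x : 'cV[R]_n, \sum_i x i 0 = 0 ->
        \sum_i (W *m x - x) i 0 ^+ 2 <= (1 - chi^-1) * \sum_i x i 0 ^+ 2].

(* The number of communication rounds performed at the steps 0, ..., k - 1; when
   step k is itself a communication round, this is also its index. *)
Definition comm_rounds (comm : pred nat) (k : nat) : nat :=
  (\sum_(t < k) comm t)%N.

(* A run, on the network E and the local functions f, of a first-order
   decentralized algorithm. *)
Record algorithm (R : realType) (n : nat) (E : nat -> rel 'I_n)
    (f : 'I_n -> ell2 R -> R) := Algorithm {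
  (* comm k: step k is a communication round; otherwise a local computation *)
  comm : pred nat ;
  memory : 'I_n -> nat -> set (ell2 R) ;
  output : 'I_n -> nat -> ell2 R ;
  memory_finite : forall i k, finite_set (memory i k) ;
  memory0 : forall i, memory i 0 = [set 0] ;
  memory_local : forall k, ~~ comm k -> forall i,
    memory i k.+1 `<=` lin_span (memory i k
      `|` [set grad (f i) x | x in memory i k]
      `|` [set grad (conjugate (f i)) x | x in memory i k]) ;
  memory_comm : forall k, comm k -> forall i,
    memory i k.+1 `<=` lin_span
      (\bigcup_(j in [set j | E (comm_rounds comm k) i j || (j == i)])
         memory j k) ;
  output_memory : forall i k, memory i k (output i k) }.

Definition accurate (R : realType) (n : nat) (E : nat -> rel 'I_n)
    (f : 'I_n -> ell2 R -> R) (A : algorithm E f) (xstar : ell2 R)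
    (eps : R) (k : nat) : Prop :=
  forall i, `|output A i k - xstar| ^+ 2 <= eps.

(* Main.v *)
(* The objective is Nesterov's quadratic chain, cut into the couplings between
   coordinates 2l and 2l+1 (held by the last third of the nodes) and those
   between 2l+1 and 2l+2 (held by the first third).  A local step of a node
   reaches at most one new coordinate, and only if the parity of the number of
   coordinates reached so far suits that node, so every new coordinate requires
   a message from one of these thirds to the other.  At each round the network
   is a star whose centre runs cyclically through the middle third of the nodes:
   a centre sends what it knew before its round, so a message needs a full cycle
   of about chi/3 rounds.  The minimiser is the geometric sequence r^(l+1) with
   1 - r of order sqrt(mu/L), hence accuracy eps forces at least of order
   sqrt(L/mu) log(1/eps) coordinates to be reached. *)
Require Import Defs.
From HB Require Import structures.
From mathcomp Require Import all_boot all_order all_algebra.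
From mathcomp Require Import all_classical all_reals all_analysis.
From mathcomp Require Import zify ring lra.

Set Implicit Arguments.
Unset Strict Implicit.
Unset Printing Implicit Defensive.

Import Order.TTheory GRing.Theory Num.Theory.
Import numFieldNormedType.Exports.
Local Open Scope classical_set_scope.
Local Open Scope ring_scope.

(** * Gradients on [ell2] *)

Section Gradients.
Context {R : realType}.
Implicit Types (f : ell2 R -> R) (x y g h v : ell2 R).

Lemma innerNr x y : inner x (- y) = - inner x y.
Proof. by rewrite -scaleN1r innerZr mulN1r. Qed.

Lemma innerBr x y z : inner x (y - z) = inner x y - inner x (z : ell2 R).
Proof. by rewrite innerDr innerNr. Qed.

Lemma innerBl x y z : inner (x - y) z = inner x z - inner y (z : ell2 R).
Proof. by rewrite innerC innerBr !(innerC z). Qed.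

Lemma normr_inner_le x y : `|inner x y| <= `|x| * `|y|.
Proof.
rewrite ler_norml inner_le_norm andbT lerNl -innerNr.
by rewrite -[`|y|]normrN; exact: inner_le_norm.
Qed.

Lemma ell2_sqr_norm x : `|x| ^+ 2 = inner x x.
Proof. exact: ell2_norm_sqr. Qed.

Lemma inner_inj g g' : (forall h, inner g h = inner g' h) -> g = g'.
Proof.
move=> E; apply/eqP; rewrite -subr_eq0; apply/eqP/inner_eq0.
by rewrite innerBl E subrr.
Qed.

Lemma gradient_unique f x g g' :
  is_gradient f x g -> is_gradient f x g' -> g = g'.
Proof.
move=> [_ E] [_ E']; apply: inner_inj => h.
by rewrite -[LHS](congr1 (@^~ h) E) -[RHS](congr1 (@^~ h) E').
Qed.

Lemma grad_eq f x g : is_gradient f x g -> grad f x = g.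
Proof.
by move=> fg; apply/(xget_unique 0 fg) => g' /gradient_unique; apply.
Qed.

(** The remainder is [O(|h|^2)], hence [o(|h|)]; Cauchy-Schwarz makes [inner g] continuous, as a
    differential must be. *)
Lemma quadratic_gradient f x g C :
  (forall h, `|f (h + x) - f x - inner g h| <= C * `|h| ^+ 2) ->
  is_gradient f x g.
Proof.
move=> fC.
have lin : linear (inner g : ell2 R -> R^o).
  by move=> a u v; rewrite innerDr innerZr.
pose lg : {linear ell2 R -> R^o} :=
  HB.pack (inner g : ell2 R -> R^o) (GRing.isLinear.Build _ _ _ _ _ lin).
have cont : continuous lg.
  apply/linear_bounded_continuous; apply/linear_boundedP.
  near=> M => y; apply: le_trans (normr_inner_le g y) _.
  by rewrite ler_wpM2r //; near: M; exact: nbhs_pinfty_ge.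
have E : (f : ell2 R -> R^o) \o shift x = cst (f x) + lg +o_ 0 id.
  apply/eqaddoP => e e0; near=> h => /=.
  rewrite -[X in `|X|]/(f (h + x) - (f x + inner g h)) opprD addrA.
  apply: le_trans (fC h) _; rewrite expr2 mulrA ler_wpM2r //.
  apply: le_trans (_ : `|C| * `|h| <= _).
    by rewrite ler_wpM2r // ler_norm.
  rewrite -[e](@divfK _ (`|C| + 1)) ?gt_eqF // ?ltr_wpDl // mulrC.
  apply: ler_pM => //; last by rewrite lerDl.
  near: h; apply/nbhs_normP; exists (e / (`|C| + 1)) => /=.
    by rewrite divr_gt0 // ltr_wpDl.
  by move=> h /=; rewrite sub0r normrN => /ltW.
have D : 'd (f : ell2 R -> R^o) x = lg :> (ell2 R -> R^o) by exact: diff_unique.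
split=> //; apply/diff_locallyP; split; first by rewrite D.
by rewrite D.
Unshelve. all: by end_near.
Qed.

(** The directional derivatives along [v] and [- v] coincide, yet are opposite by linearity, so both
    vanish. *)
Lemma gradient_even f x g v : is_gradient f x g ->
  (forall t : R, f (t *: - v + x) = f (t *: v + x)) -> inner g v = 0.
Proof.
move=> [df E] fev.
have : 'D_(- v) (f : ell2 R -> R^o) x = 'D_v (f : ell2 R -> R^o) x.
  apply: (congr1 (fun D : R -> R^o => lim (D @ 0^'))).
  by apply/funext => t /=; rewrite fev.
rewrite !deriveE // E innerNr => /eqP.
by rewrite eq_sym -addr_eq0 -mulr2n mulrn_eq0 /= => /eqP.
Qed.

Lemma quadratic_smooth_strongly_convex (mu L : R) f (G : ell2 R -> ell2 R) :
  0 <= mu ->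
  (forall x h, mu / 2 * `|h| ^+ 2 <= f (h + x) - f x - inner (G x) h
     <= L / 2 * `|h| ^+ 2) ->
  smooth_strongly_convex mu L f /\ forall x, grad f x = G x.
Proof.
move=> mu0 fb.
have fG x : is_gradient f x (G x).
  apply: (@quadratic_gradient _ _ _ (L / 2)) => h.
  have /andP[l u] := fb x h; rewrite ger0_norm //.
  by apply: le_trans l; rewrite mulr_ge0 ?divr_ge0.
have gG x : grad f x = G x by exact: grad_eq.
split=> //; split=> [y|x y]; first by rewrite gG.
by have := fb y (x - y); rewrite subrK gG; lra.
Qed.

End Gradients.

(** * Pair swaps, sign reflections and supports *)

Section Operators.
Context {R : realType}.
Implicit Types (x y : ell2 R) (b : bool) (K l k n : nat).

Lemma cvg_series_finite_support (u : nat -> R) K :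
  (forall l, (K <= l)%N -> u l = 0) -> series u @ \oo --> \sum_(0 <= l < K) u l.
Proof.
move=> u0; apply: cvg_near_cst; exists K => // n /= Kn.
rewrite /series /= (big_cat_nat (leq0n K) Kn) /= [X in _ + X]big_nat_cond.
rewrite [X in _ + X]big1 ?addr0 // => i /andP[/andP[Ki _] _].
exact: u0.
Qed.

Lemma basis_subproof l : (fun j => (j == l)%:R : R) \in square_summable.
Proof.
apply/asboolP/cvg_ex; eexists; apply: (@cvg_series_finite_support _ l.+1) => j.
by move=> lj; rewrite gtn_eqF // expr0n.
Qed.

Definition basis l : ell2 R := Ell2 (basis_subproof l).

Lemma basisE l j : basis l j = (j == l)%:R.
Proof. by []. Qed.

Lemma inner_basisr x l : inner x (basis l) = x l.
Proof.
apply/cvg_lim => //; have -> : x l = \sum_(0 <= j < l.+1) x j * basis l j.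
  rewrite big_nat_recr // big_nat_cond big1 /= ?eqxx ?mulr1 ?add0r // => j.
  by rewrite andbT => jl; rewrite ltn_eqF // mulr0.
apply: cvg_series_finite_support => j lj.
by rewrite basisE gtn_eqF // mulr0.
Qed.

Lemma ell2_ext x y : (forall l, x l = y l) -> x = y.
Proof. by move=> xy; apply/val_inj/funext. Qed.

Lemma ell2DE x y l : (x + y) l = x l + y l. Proof. by []. Qed.
Lemma ell2NE x l : (- x) l = - x l. Proof. by []. Qed.
Lemma ell2ZE (a : R) x l : (a *: x) l = a * x l. Proof. by []. Qed.
Lemma ell20E l : (0 : ell2 R) l = 0. Proof. by []. Qed.

Lemma ell2_sumE (I : Type) (r : seq I) (P : pred I) (F : I -> ell2 R) l :
  (\sum_(i <- r | P i) F i) l = \sum_(i <- r | P i) F i l.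
Proof.
exact: (big_morph (fun x : ell2 R => x l) (fun x y => ell2DE x y l)).
Qed.

(* [pair_swap false] exchanges 0 and 1, 2 and 3, ...; [pair_swap true] fixes 0
   and exchanges 1 and 2, 3 and 4, ... *)
Definition pair_swap b l : nat := if odd l == b then l.+1 else l.-1.

Lemma pair_swapK b : involutive (pair_swap b).
Proof. by move=> l; rewrite /pair_swap; case: b; do 2 case: ifP; lia. Qed.

(** When [K] has parity [b] it is the left element of its pair, so no exchanged pair straddles the
    cut at [K]. *)
Lemma pair_swap_lt b K l : odd K = b -> (pair_swap b l < K)%N = (l < K)%N.
Proof. by rewrite /pair_swap => <-; case: ifP; lia. Qed.

Lemma sum_pair_swap b k (F : nat -> R) :
  \sum_(0 <= l < (b + k.*2)%N) F (pair_swap b l) =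
  \sum_(0 <= l < (b + k.*2)%N) F l.
Proof.
elim: k => [|k IH]; first by case: b; rewrite /= ?big_nat1 ?big_geq.
rewrite doubleS !addnS !big_nat_recr //= IH -!addrA; congr (_ + _).
have -> : pair_swap b (b + k.*2) = (b + k.*2).+1.
  by rewrite /pair_swap oddD odd_double addbF oddb eqxx.
have -> : pair_swap b (b + k.*2).+1 = (b + k.*2)%N.
  by rewrite /pair_swap /= oddD odd_double addbF oddb; case: (b).
by rewrite addrC.
Qed.

Lemma swap_subproof b x : (fun l => x (pair_swap b l)) \in square_summable.
Proof.
apply/asboolP; have /asboolP cx := ell2P x.
have mono (y : nat -> R) : nondecreasing_seq (series (fun l => y l ^+ 2)).
  by apply: nondecreasing_series => i _ _; rewrite sqr_ge0.
apply: nondecreasing_is_cvgn; first exact: mono.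
exists (limn (series (fun l => x l ^+ 2))) => _ [n _ <-].
(* Lengths [b + n.*2] cut no pair, so there the partial sums of [x] and of its swap coincide. *)
apply: (@le_trans _ _ (series (fun l => x (pair_swap b l) ^+ 2) (b + n.*2)%N)).
  by apply: mono; rewrite -addnn addnCA leq_addr.
rewrite /series /= (sum_pair_swap b n (fun l => x l ^+ 2)).
exact: (nondecreasing_cvgn_le (mono x) cx).
Qed.

Definition swap b x : ell2 R := Ell2 (swap_subproof b x).

Lemma swapE b x l : swap b x l = x (pair_swap b l).
Proof. by []. Qed.

Lemma swapD b x y : swap b (x + y) = swap b x + swap b y.
Proof. exact: ell2_ext. Qed.

Lemma swapK b : involutive (swap b).
Proof. by move=> x; apply: ell2_ext => l; rewrite !swapE pair_swapK. Qed.

(** Partial sums of the lengths [b + k.*2] agree exactly, and this subsequence determines both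
    limits. *)
Lemma inner_swapl b x y : inner (swap b x) y = inner x (swap b y).
Proof.
have sub : (fun k => (b + k.*2)%N) @ \oo --> \oo.
  apply/cvgnyPge => M; exists M => // k /= Mk; lia.
have lim2 (u v : ell2 R) :
    (fun k => series (fun l => u l * v l) (b + k.*2)%N) @ \oo --> inner u v.
  exact: (cvg_comp _ _ sub (@inner_cvg R u v)).
have E : (fun k => series (fun l => swap b x l * y l) (b + k.*2)%N) =
    (fun k => series (fun l => x l * swap b y l) (b + k.*2)%N).
  apply/funext => k; rewrite /series /=.
  rewrite -(sum_pair_swap b k (fun l => x (pair_swap b l) * y l)).
  by apply: eq_bigr => l _; rewrite pair_swapK.
have := lim2 (swap b x) y; rewrite E => l1.
exact: (cvg_unique _ l1 (lim2 x (swap b y))).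
Qed.

Lemma inner_swap2 b x : inner (swap b x) (swap b x) = inner x x.
Proof. by rewrite inner_swapl swapK. Qed.

Lemma inner_swap_bounds b x : `|inner x (swap b x)| <= inner x x.
Proof.
rewrite ler_norml -subr_ge0 -[X in _ && X]subr_ge0.
have /= := inner_ge0 (x + swap b x); have := inner_ge0 (x - swap b x).
rewrite !(innerBl, innerDl, innerBr, innerDr) !inner_swap2 !inner_swapl; lra.
Qed.

(** [swap true] fixes index 0, so coordinate 0 of [x + swap true x] is twice [x 0]; its square is at
    most the squared norm. *)
Lemma inner_swap_coord0 x : x 0 ^+ 2 *+ 2 <= inner x x + inner x (swap true x).
Proof.
have := inner_ge_coord (x + swap true x) 0; rewrite ell2DE swapE /=.
rewrite !(innerDl, innerDr) !inner_swap2 !inner_swapl; lra.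
Qed.

Lemma reflect_subproof K x :
  (fun l => if (l < K)%N then x l else - x l) \in square_summable.
Proof.
apply/asboolP; have /asboolP cx := ell2P x.
rewrite (_ : (fun l => _ ^+ 2) = (fun l => x l ^+ 2)) //.
by apply/funext => l; case: ifP => //; rewrite sqrrN.
Qed.

(** Invariance under this sign change passes from a function to its conjugate, which controls the
    supports of both gradients without computing the conjugate. *)
Definition reflect K x : ell2 R := Ell2 (reflect_subproof K x).

Lemma reflectE K x l : reflect K x l = if (l < K)%N then x l else - x l.
Proof. by []. Qed.

Lemma reflectK K : involutive (reflect K).
Proof.
move=> x; apply: ell2_ext => l.
by rewrite !reflectE; case: leqP; rewrite ?opprK.
Qed.

Lemma inner_reflect K x y : inner (reflect K x) (reflect K y) = inner x y.
Proof.
congr (limn (series _)); apply/funext => l; rewrite !reflectE.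
by case: ifP; rewrite ?mulrNN.
Qed.

Lemma reflect_swap b K x : odd K = b ->
  swap b (reflect K x) = reflect K (swap b x).
Proof.
by move=> Kb; apply: ell2_ext => l; rewrite swapE !reflectE swapE pair_swap_lt.
Qed.

Definition supported K : set (ell2 R) :=
  [set x | forall l, (K <= l)%N -> x l = 0].

Lemma supported_mono K K' x : (K <= K')%N -> supported K x -> supported K' x.
Proof. by move=> KK' xK l /(leq_trans KK'); apply: xK. Qed.

Lemma supported_span K (A : set (ell2 R)) :
  A `<=` supported K -> lin_span A `<=` supported K.
Proof.
move=> AK _ [m [a [x [Ax ->]]]] l Kl; rewrite ell2_sumE big1 // => i _.
by rewrite ell2ZE (AK _ (Ax i)) // mulr0.
Qed.

(** At such an [x], [f] is even along [basis l] for every [l >= K], so that coordinate of the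
    gradient vanishes. Where there is no gradient, the default value 0 of [grad] is supported
    too. *)
Lemma supported_gradient K (f : ell2 R -> R) x :
  (forall y, f (reflect K y) = f y) -> supported K x -> supported K (grad f x).
Proof.
move=> fK xK; rewrite /grad.
case: xgetP => [g _ /= fg|_] l Kl; last exact: ell20E.
rewrite -inner_basisr; apply: gradient_even fg _ => t.
rewrite -[RHS]fK; congr f; apply: ell2_ext => j.
rewrite reflectE !ell2DE !ell2ZE ell2NE basisE; case: ltnP => [jK|/xK ->].
  by rewrite ltn_eqF ?(leq_trans jK) // oppr0.
by rewrite !addr0 mulrN.
Qed.

Lemma conjugate_reflect K (f : ell2 R -> R) :
  (forall y, f (reflect K y) = f y) ->
  forall y, conjugate f (reflect K y) = conjugate f y.
Proof.
move=> fK y; congr sup; apply/seteqP; split=> _ [z _ <-];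
  by exists (reflect K z) => //; rewrite -(inner_reflect K) ?reflectK fK.
Qed.

End Operators.

(** * The gossip matrix of a star *)

Section Star.
Context {R : realType} (n : nat) (c : 'I_n).

Definition star : rel 'I_n := fun i j => (i != j) && ((i == c) || (j == c)).

(* The Laplacian of the star divided by its largest eigenvalue n. *)
Definition star_gossip : 'M[R]_n := \matrix_(i, j)
  (n%:R^-1 * ((i == j)%:R - (j == c)%:R - (i == c)%:R
              + n%:R * (i == c)%:R * (j == c)%:R)).

Lemma sum_indicator (I : finType) (a : I) (u : I -> R) :
  \sum_i (i == a)%:R * u i = u a.
Proof.
rewrite (bigD1 a) //= eqxx mul1r big1 ?addr0 // => i /negPf ->.
by rewrite mul0r.
Qed.

Lemma star_gossipE (x : 'cV[R]_n) i : (star_gossip *m x) i 0 =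
  n%:R^-1 * (x i 0 - x c 0 - (i == c)%:R * (\sum_j x j 0)
             + n%:R * (i == c)%:R * x c 0).
Proof.
rewrite mxE -[in RHS](sum_indicator i (fun j => x j 0)).
rewrite -!(sum_indicator c (fun j => x j 0)) !mulr_sumr -!sumrB -big_split /=.
rewrite mulr_sumr; apply: eq_bigr => j _; rewrite mxE (eq_sym i j); ring.
Qed.

Hypothesis n2 : (2 <= n)%N.

Let n0 : n%:R != 0 :> R. Proof. by rewrite pnatr_eq0; case: n n2. Qed.

(** With [t = 1/n] and zero sum, the residual is [- (1 - t) x_i - t x_c] off the centre and 0 at the
    centre. *)
Lemma star_gossip_norm (x : 'cV[R]_n) : \sum_i x i 0 = 0 ->
  \sum_i (star_gossip *m x - x) i 0 ^+ 2 =
  (1 - n%:R^-1) ^+ 2 * (\sum_i x i 0 ^+ 2) - (1 - n%:R^-1) * x c 0 ^+ 2.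
Proof.
move=> x0; set t := n%:R^-1.
have tn : t * n%:R = 1 by rewrite mulVf.
under eq_bigr => i _.
  rewrite mxE star_gossipE x0 mulr0 subr0 [X in _ + X]mxE -/t.
  rewrite (_ : _ ^+ 2 = (1 - t) ^+ 2 * x i 0 ^+ 2
    + (1 - t) * t * x c 0 *+ 2 * x i 0 + t ^+ 2 * x c 0 ^+ 2
    - (i == c)%:R * x c 0 ^+ 2); first over.
  rewrite mulrDr !mulrA tn mul1r.
  by have [->|_] := eqVneq i c; rewrite /=; ring.
rewrite sumrB !big_split /= -!mulr_sumr x0 mulr0 addr0.
rewrite (sum_indicator c (fun=> x c 0 ^+ 2)) sumr_const card_ord -mulr_natr.
have -> : t ^+ 2 * (x c 0 * (x c 0 * n%:R)) = t * x c 0 ^+ 2.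
  transitivity ((t * n%:R) * (t * x c 0 ^+ 2)); last by rewrite tn mul1r.
  by move: (n%:R : R) (x c 0) => N u; clearbody t; ring.
by ring.
Qed.

(** For the contraction property, drop the nonpositive centre term and use
    [(1 - 1/n)^2 <= 1 - 1/n <= 1 - 1/chi]. *)
Lemma star_gossip_matrix (chi : R) : n%:R <= chi ->
  gossip_matrix chi star star_gossip.
Proof.
move=> nchi; have npos : 0 < n%:R :> R by rewrite ltr0n; case: n n2.
have n1 : 1 < n%:R :> R by rewrite ltr1n.
split.
- move=> i j; rewrite mxE /star mulf_eq0 invr_eq0 (negPf n0) /=.
  have [<-|ij] := eqVneq i j.
    by rewrite orbT; have [_|_] := eqVneq i c; apply/eqP => /=; lra.
  rewrite orbF /=; have [ic|ic] := eqVneq i c; have [jc|jc] /= := eqVneq j c.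
  + by case/eqP: ij; rewrite ic jc.
  + by apply/eqP; lra.
  + by apply/eqP; lra.
  + by apply/eqP; lra.
- move=> x xc; apply/matrixP => i j; rewrite ord1 star_gossipE mxE.
  rewrite (xc i c) (eq_bigr (fun=> x c 0)) => [|k _]; last exact: xc.
  by rewrite sumr_const card_ord -mulr_natr; ring.
- move=> x; under eq_bigr do rewrite star_gossipE.
  rewrite -mulr_sumr big_split !sumrB /= sumr_const card_ord.
  under [X in _ + X]eq_bigr do rewrite -mulrA mulrCA.
  rewrite (sum_indicator c (fun=> \sum_j x j 0)).
  rewrite (sum_indicator c (fun=> n%:R * x c 0)) -mulr_natl; ring.
- move=> x x0; rewrite star_gossip_norm //.
  have S0 : 0 <= \sum_i x i 0 ^+ 2 by apply: sumr_ge0 => i _; rewrite sqr_ge0.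
  have tpos : 0 < n%:R^-1 :> R by rewrite invr_gt0.
  have t1 : n%:R^-1 < 1 :> R by rewrite invf_lt1.
  have tchi : chi^-1 <= n%:R^-1 by rewrite lef_pV2 ?posrE // (lt_le_trans npos).
  apply: le_trans (_ : (1 - n%:R^-1) * \sum_i x i 0 ^+ 2 <= _); last first.
    by rewrite ler_wpM2r // lerD2l lerN2.
  apply: le_trans (_ : (1 - n%:R^-1) ^+ 2 * \sum_i x i 0 ^+ 2 <= _).
    by rewrite gerBl mulr_ge0 ?sqr_ge0 // subr_ge0 ltW.
  rewrite expr2 ler_wpM2r // ler_piMr ?subr_ge0 ?ltW //; lra.
Qed.

End Star.

(** * The local quadratics and the minimiser of a sum *)

Section LocalFunctions.
Context {R : realType}.
Implicit Types (x y h : ell2 R) (b : bool).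

(* The sum of [(x l - x (pair_swap b l))^2] over the pairs exchanged by
   [pair_swap b], plus [(x 0 - 1)^2] if [b]; [chain_grad] is half its gradient. *)
Definition chain b x : R :=
  b%:R * (x 0 - 1) ^+ 2 + inner x x - inner x (swap b x).

Definition chain_grad b x : ell2 R :=
  (b%:R * (x 0 - 1)) *: basis 0 + x - swap b x.

Lemma chainD b h x : chain b (h + x) = chain b x + inner (chain_grad b x) h *+ 2
  + (b%:R * h 0 ^+ 2 + inner h h - inner h (swap b h)).
Proof.
rewrite /chain /chain_grad ell2DE swapD !innerBl !innerDl !innerZl !innerDr.
rewrite (innerC (basis 0)) inner_basisr inner_swapl (innerC h x).
rewrite -(inner_swapl b h x) (innerC (swap b h)).
by case: b; rewrite /=; ring.
Qed.

(** For [b] true the extra [h 0 ^+ 2] is absorbed by [inner_swap_coord0], so the constant 2 serves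
    both parities. *)
Lemma chain_quadratic_bounds b h :
  0 <= b%:R * h 0 ^+ 2 + inner h h - inner h (swap b h) <= 2 * inner h h.
Proof.
have := inner_swap_bounds b h; have := inner_swap_coord0 h.
have := sqr_ge0 (h 0); rewrite ler_norml; case: b => /= *; lra.
Qed.

(** For [b] true, [K] is odd, hence positive, so the anchored coordinate 0 keeps its sign. *)
Lemma chain_reflect b K x : odd K = b -> chain b (reflect K x) = chain b x.
Proof.
move=> Kb; rewrite /chain reflect_swap // !inner_reflect reflectE.
by case: K Kb => // <-; rewrite !mul0r.
Qed.

(** The quadratic part of [chain] is at most [2 * inner h h], so the factor [w / 4] adds curvature
    at most [w], and [w <= L - mu] gives [L]-smoothness. *)
Definition local_fun (mu w : R) b x : R :=
  mu / 2 * inner x x + w / 4 * chain b x.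

Lemma local_fun_smooth (mu L w : R) b : 0 <= mu -> 0 <= w <= L - mu ->
  smooth_strongly_convex mu L (local_fun mu w b) /\
  forall x, grad (local_fun mu w b) x = mu *: x + (w / 2) *: chain_grad b x.
Proof.
move=> mu0 /andP[w0 wL]; apply: quadratic_smooth_strongly_convex => // x h.
rewrite ell2_sqr_norm /local_fun chainD /= (innerDl h x) !(innerDr h x).
rewrite (innerDl (mu *: x)) !innerZl (innerC h x).
have := chain_quadratic_bounds b h.
move: (inner (chain_grad b x) h) => g.
set q := (X in _ <= X <= _) => /andP[q0 qh].
have wq : 0 <= w * q by rewrite mulr_ge0.
have wh : w * q <= (L - mu) * (2 * inner h h) by apply: ler_pM.
by rewrite -/q; clearbody q; apply/andP; split; lra.
Qed.

Lemma inner0l x : inner 0 x = 0.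
Proof. by rewrite -(scale0r x) innerZl mul0r. Qed.

Lemma strongly_convex_minimizer n (f : 'I_n -> ell2 R -> R) (mu L : R) x :
  (0 < n)%N -> 0 < mu -> (forall i, smooth_strongly_convex mu L (f i)) ->
  \sum_i grad (f i) x = 0 ->
  unique (is_minimizer (fun y => \sum_i f i y)) x.
Proof.
move=> n0 mu0 fs gx.
have lb y : \sum_i f i x + n%:R * (mu / 2 * `|y - x| ^+ 2) <= \sum_i f i y.
  have -> : \sum_i f i x + n%:R * (mu / 2 * `|y - x| ^+ 2) =
      \sum_i (f i x + inner (grad (f i) x) (y - x) + mu / 2 * `|y - x| ^+ 2).
    rewrite !big_split /= sumr_const card_ord mulr_natl -(big_morph
      (inner^~ (y - x)) (fun u v => innerDl u v (y - x)) (inner0l _)).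
    by rewrite gx inner0l addr0.
  by apply: ler_sum => i _; have [_ /(_ y x) /andP[]] := fs i.
have pos : 0 < n%:R * (mu / 2) by rewrite mulr_gt0 ?ltr0n ?divr_gt0.
split=> [y|y /(_ x) yx].
  by apply: le_trans (lb y); rewrite lerDl mulrA mulr_ge0 ?exprn_ge0 // ltW.
have := le_trans (lb y) yx; rewrite gerDl mulrA pmulr_rle0 // => yx0.
have /eqP : `|y - x| ^+ 2 = 0 by apply/eqP; rewrite eq_le yx0 exprn_ge0.
by rewrite sqrf_eq0 normr_eq0 subr_eq0 => /eqP.
Qed.

End LocalFunctions.

(** * Spread of coordinates through the rotating star *)

Section Network.
Context (m : nat).
Implicit Types (q i j : nat).

(* Upper bound on the number of leading coordinates which can be nonzero in the
   memory of node i after q communication rounds. *)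
Definition reach q i : nat := (q %/ m +
  if i < m then ~~ odd (q %/ m) else
  if i < 2 * m then i - m < q %% m else odd (q %/ m))%N.

Hypothesis m0 : (0 < m)%N.

Lemma reach_ge q i : (q %/ m <= reach q i)%N.
Proof. exact: leq_addr. Qed.

Lemma reach_le q i : (reach q i <= (q %/ m).+1)%N.
Proof.
by rewrite -addn1 leq_add2l; case: ifP => _; [|case: ifP => _]; exact: leq_b1.
Qed.

(** Before round [q], its centre has not yet served in the current cycle. *)
Lemma reach_center q : reach q (m + q %% m) = (q %/ m)%N.
Proof.
by rewrite /reach; have := ltn_pmod q m0; (case: ifP; last case: ifP); lia.
Qed.

Lemma divn_modnS q : (q.+1 %/ m, q.+1 %% m)%N =
  if ((q %% m).+1 < m)%N then (q %/ m, (q %% m).+1)%N else ((q %/ m).+1, 0)%N.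
Proof.
have qE : q.+1 = (q %/ m * m + (q %% m).+1)%N by rewrite addnS -divn_eq.
have := ltn_pmod q m0; rewrite qE; move: (q %/ m)%N (q %% m)%N => p r rm.
case: ltnP => [rm'|mr].
  by rewrite divnMDl // divn_small // modnMDl modn_small // addn0.
have -> : r.+1 = m by apply/eqP; rewrite eqn_leq rm mr.
by rewrite -mulSnr mulnK // modnMl.
Qed.

Lemma reach_centerS q : ((q %/ m).+1 <= reach q.+1 (m + q %% m))%N.
Proof.
have := ltn_pmod q m0; rewrite /reach; move: (divn_modnS q).
by case: ifP => H [-> ->]; (case: ifP; last case: ifP); lia.
Qed.

(** The extra coordinate of a node can be lost only at the end of a cycle, when the quotient grows
    by one. *)
Lemma reach_mono q i : (reach q i <= reach q.+1 i)%N.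
Proof.
have := ltn_pmod q m0; rewrite /reach; move: (divn_modnS q).
by case: ifP => H [-> ->]; (case: ifP; last case: ifP); lia.
Qed.

Lemma center_subproof q : (m + q %% m < 3 * m)%N.
Proof. by have := ltn_pmod q m0; lia. Qed.

Definition center q : 'I_(3 * m) := Ordinal (center_subproof q).

(** A message to the centre brings at most [(q %/ m).+1] coordinates, which the centre is granted
    after the round; a message from it carries only the [q %/ m] coordinates already granted to
    every node. *)
Lemma reach_star q (i j : 'I_(3 * m)) :
  star (center q) i j || (j == i) -> (reach q j <= reach q.+1 i)%N.
Proof.
case/orP => [/andP[_ /orP[] /eqP ->]|/eqP ->]; last exact: reach_mono.
  exact: leq_trans (reach_le q j) (reach_centerS q).
rewrite reach_center; apply: leq_trans (reach_mono q i); exact: reach_ge.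
Qed.

Section Functions.
Context {R : realType} (mu w : R).

Definition node_weight i : R := if (m <= i < 2 * m)%N then 0 else w.

Definition node_fun i : ell2 R -> R := local_fun mu (node_weight i) (i < m)%N.

(** [reach] is odd on the first third and even on the last, matching the parity of the chain held
    there; on the middle third the chain has weight 0. *)
Lemma node_fun_reflect q i x :
  node_fun i (reflect (reach q i) x) = node_fun i x.
Proof.
rewrite /node_fun /local_fun inner_reflect /node_weight /reach.
have [im|mi] := ltnP i m; last have [im2|mi2] := ltnP i (2 * m).
- by rewrite chain_reflect // oddD; case: (odd _).
- by rewrite /= !mul0r.
- by rewrite chain_reflect // oddD; case: (odd _).
Qed.

Lemma sum_nodes (V : lmodType R) (a b0 b1 : V) :
  \sum_(i < 3 * m) (a + (node_weight i / 2) *: (if (i < m)%N then b1 else b0)) =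
  (a *+ 3 + (w / 2) *: (b1 + b0)) *+ m.
Proof.
pose G i := a + (node_weight i / 2) *: (if (i < m)%N then b1 else b0).
rewrite -(big_mkord xpredT G) (@big_cat_nat _ _ _ m) //=; last by lia.
rewrite (@big_cat_nat _ _ _ (2 * m) m) //=; try lia.
rewrite (@eq_big_nat _ _ _ 0 m G (fun=> a + (w / 2) *: b1)); last first.
  by move=> i /andP[_ im]; rewrite /G /node_weight im leqNgt im.
rewrite (@eq_big_nat _ _ _ m (2 * m) G (fun=> a)); last first.
  by move=> i im; rewrite /G /node_weight im mul0r scale0r addr0.
rewrite (@eq_big_nat _ _ _ (2 * m) (3 * m) G (fun=> a + (w / 2) *: b0));
  last first.
  by move=> i im; rewrite /G /node_weight !ifF //; lia.
rewrite !sumr_const_nat.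
have -> : (3 * m - 2 * m = m)%N by lia.
have -> : (2 * m - m = m)%N by lia.
rewrite subn0 -!mulrnDl; congr (_ *+ m).
by rewrite scalerDr [LHS]addrA (addrAC a _ a) addrACA -mulr2n -mulrSr.
Qed.

(** Induction on steps: communication follows [reach_star]; a local step keeps the bound, since
    [node_fun] and its conjugate are invariant under reflection there. *)
Lemma memory_supported (A : algorithm (fun q => star (center q))
    (fun i : 'I_(3 * m) => node_fun i)) k (i : 'I_(3 * m)) :
  memory A i k `<=` supported (reach (comm_rounds (comm A) k) i).
Proof.
elim: k i => [|k IH] i.
  by rewrite memory0 => _ -> l _; exact: ell20E.
have E : comm_rounds (comm A) k.+1 = (comm_rounds (comm A) k + comm A k)%N.
  by rewrite /comm_rounds big_ord_recr.
rewrite E; case: (boolP (comm A k)) => [ck|ck]; rewrite ?addn1 ?addn0.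
  move=> x /(memory_comm ck); apply: supported_span => {}x.
  by case=> j /= /reach_star ji /IH; exact: supported_mono.
move=> x /(memory_local ck); apply: supported_span => {}x.
have f_even := node_fun_reflect (comm_rounds (comm A) k) i.
case=> [[/IH //|[y /IH yK <-]]|[y /IH yK <-]]; apply: supported_gradient => //.
exact: conjugate_reflect.
Qed.

End Functions.
End Network.

(** * The geometric minimiser and its decay *)

Section Geometric.
Context {R : realType}.
Implicit Types (r s : R).

Lemma geometric_subproof r :
  `|r| < 1 -> (fun l => r ^+ l.+1) \in square_summable.
Proof.
move=> r1; apply/asboolP.
rewrite (_ : (fun l => _) = geometric (r ^+ 2) (r ^+ 2)).
  by apply: is_cvg_geometric_series; rewrite normrX expr_lt1.
by apply/funext => l /=; rewrite -exprS -!exprM mulnC.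
Qed.

Definition geom r (r1 : `|r| < 1) : ell2 R := Ell2 (geometric_subproof r1).

(** The hypothesis is the characteristic equation of the three-term recurrence; at coordinate 0 the
    anchor value 1 stands for the missing term [r ^+ 0]. *)
Lemma chain_stationary (mu w r : R) (r1 : `|r| < 1) :
  3 * mu * r = w / 2 * (1 - r) ^+ 2 ->
  (mu *: geom r1) *+ 3 +
    (w / 2) *: (chain_grad true (geom r1) + chain_grad false (geom r1)) = 0.
Proof.
move=> E; apply: ell2_ext => l; rewrite -scaler_nat.
rewrite /chain_grad !(ell2DE, ell2ZE, ell2NE) !swapE !basisE ell20E.
rewrite /pair_swap /=.
case: l => [|l] /=; first by rewrite expr1; lra.
have -> : r ^+ l.+2 = r ^+ l * (r * r) by rewrite -expr2 -exprD addn2.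
case: (odd l) => /=; rewrite -?(addn3 l) ?exprD ?exprS;
  have := congr1 ( *%R (r ^+ l * r)) E; lra.
Qed.

(** Up to a square factor, [s ^+ 2] is the discriminant of this quadratic in [r], and this [r] is
    its root below 1. *)
Lemma contraction_stationary (mu w s : R) : 0 < mu -> 1 < s ->
  s ^+ 2 = 1 + 2 * w / (3 * mu) ->
  let r := (s - 1) / (s + 1) in 3 * mu * r = w / 2 * (1 - r) ^+ 2.
Proof.
move=> mu0 s1 sE r.
have -> : w = 3 * mu / 2 * (s ^+ 2 - 1) by rewrite sE; field; lra.
by rewrite /r; field; lra.
Qed.

Lemma contraction_bounds s : 1 < s -> 0 < (s - 1) / (s + 1) < 1.
Proof.
move=> s1; have s0 : 0 < s + 1 by lra.
by rewrite divr_gt0 ?ltr_pdivrMr //=; lra.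
Qed.

(** Since [1 / r = 1 + 2 / (s - 1)], [ln (1 / r) <= 2 / (s - 1)]; the exponent [2K] gives the 4. *)
Lemma contraction_rate s eps K : 1 < s -> 0 < eps ->
  (((s - 1) / (s + 1)) ^+ K) ^+ 2 <= eps -> ln eps^-1 <= K%:R * (4 / (s - 1)).
Proof.
move=> s1 eps0; have /andP[r0 r1] := contraction_bounds s1.
set r := (s - 1) / (s + 1) in r0 r1 *.
rewrite -exprM => rK; rewrite lnV ?posrE // lerNl.
have : ln (r ^+ (K * 2)) <= ln eps by rewrite ler_ln ?posrE ?exprn_gt0.
apply: le_trans; rewrite lnXn // lerNl -mulNrn -lnV ?posrE //.
have -> : r^-1 = 1 + 2 / (s - 1) by rewrite /r; field; lra.
have s0 : 0 < 2 / (s - 1) by rewrite divr_gt0 // subr_gt0.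
have : ln (1 + 2 / (s - 1)) <= 2 / (s - 1) by apply: le_ln1Dx; lra.
move/(ler_wMn2r (K * 2)) => /le_trans; apply.
rewrite -[leLHS]mulr_natl natrM le_eqVlt; apply/orP; left; apply/eqP.
by field; lra.
Qed.

End Geometric.

(** * Choice of parameters and the final count *)

Theorem theorem2 (R : realType) :
  exists c kappa : R, 0 < c /\
  forall chi L mu : R, 3 <= chi -> 0 < mu -> mu < L ->
  exists (n : nat) (E : nat -> rel 'I_n) (W : nat -> 'M[R]_n)
         (f : 'I_n -> ell2 R -> R) (xstar : ell2 R),
    [/\ (0 < n)%N,
        forall q, irreflexive (E q),
        forall q, gossip_matrix chi (E q) (W q),
        forall i, smooth_strongly_convex mu L (f i)
      & unique (is_minimizer (fun x => \sum_(i < n) f i x)) xstar] /\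
    (kappa < L / mu ->
     exists eps0 : R, 0 < eps0 /\
     forall (eps : R) (A : algorithm E f) (k : nat),
       0 < eps -> eps < eps0 -> accurate A xstar eps k ->
       c * (chi * Num.sqrt (L / mu) * ln (eps^-1))
         <= (comm_rounds (comm A) k)%:R).
Proof.
(* [192 = 6 * 32] combines [chi <= 6m] with [z * l <= 32p]; [6 < L / mu] yields [z > 2] and
   [s > 2]. *)
exists (192^-1), 6; split; first by rewrite invr_gt0.
move=> chi L mu chi3 mu0 muL.
(* The largest [m] with [3m <= chi], so that [3m] nodes meet the contraction property. *)
pose m := Num.truncn (chi / 3).
have /andP[mchi chim] : m%:R <= chi / 3 < m.+1%:R by apply: truncn_itv; lra.
have m0 : (0 < m)%N by rewrite -ltnS -(ltr_nat R); lra.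
have n0 : (0 < 3 * m)%N by rewrite muln_gt0.
have a0 : 0 < 2 * (L - mu) / (3 * mu) by rewrite divr_gt0 ?mulr_gt0 ?subr_gt0.
pose s : R := Num.sqrt (1 + 2 * (L - mu) / (3 * mu)).
have sE : s ^+ 2 = 1 + 2 * (L - mu) / (3 * mu).
  by rewrite sqr_sqrtr //; lra.
have s1 : 1 < s.
  by rewrite -[ltLHS]sqrtr1 ltr_sqrt; lra.
have /andP[r0 r1] := contraction_bounds s1.
pose r : R := (s - 1) / (s + 1).
have r1' : `|r| < 1 by rewrite gtr0_norm.
have wb i : 0 <= node_weight m (L - mu) i <= L - mu.
  by rewrite /node_weight; case: ifP => _; lra.
have fs (i : nat) := local_fun_smooth (i < m)%N (ltW mu0) (wb i).
exists (3 * m)%N, (fun q => star (center m0 q)),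
  (fun q => star_gossip (center m0 q)).
exists (fun i => node_fun m mu (L - mu) i), (geom r1').
split.
  split=> //.
  - by move=> q i; rewrite /star eqxx.
  - move=> q; apply: star_gossip_matrix; first by lia.
    by rewrite natrM; lra.
  - by move=> i; have [] := fs i.
  apply: (strongly_convex_minimizer (L := L) n0 mu0) => [i|].
    by have [] := fs i.
  rewrite (eq_bigr (fun i : 'I_(3 * m) => mu *: geom r1' +
    (node_weight m (L - mu) i / 2) *:
      (if (i < m)%N then chain_grad true (geom r1')
       else chain_grad false (geom r1')))); last first.
    by move=> i _; have [_ E] := fs i; rewrite [LHS]E; case: ltnP.
  rewrite sum_nodes // chain_stationary ?mul0rn //.
  exact: contraction_stationary.
(* Forces [ln (1 / eps) >= 32], hence [z * l >= 64], which absorbs the additive 32 in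
   [16 * p.+2]. *)
move=> kappa6; exists (expR (- 32)); split; first exact: expR_gt0.
move=> eps A k eps0 eps32 /(_ (Ordinal n0)) acc.
set q := comm_rounds _ _; pose p := (q %/ m)%N.
have pq : (p * m <= q)%N by exact: leq_divM.
have outK := memory_supported (output_memory A (Ordinal n0) k).
(* At most [p.+1] coordinates are reached, so that of index [p.+1] is still 0, where the minimiser
   has [r ^+ p.+2]. *)
have out0 : output A (Ordinal n0) k p.+1 = 0 by apply: outK; exact: reach_le.
have rp : (r ^+ p.+2) ^+ 2 <= eps.
  apply: le_trans acc; rewrite ell2_sqr_norm.
  apply: le_trans (inner_ge_coord _ p.+1).
  by rewrite ell2DE out0 ell2NE add0r sqrrN.
have := contraction_rate s1 eps0 rp.
have l32 : 32 <= ln eps^-1.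
  by rewrite lnV ?posrE // lerNr -(expRK (- 32)) ler_ln ?posrE ?expR_gt0 // ltW.
move: (ln eps^-1) l32 => l l32 lp.
pose z : R := Num.sqrt (L / mu); rewrite -/z.
have z2 : z ^+ 2 = L / mu.
  by rewrite sqr_sqrtr // divr_ge0 // ltW // (lt_trans mu0).
have z0 : 0 <= z by exact: sqrtr_ge0.
have sz : s ^+ 2 = (1 + 2 * z ^+ 2) / 3 by rewrite sE z2; field; lra.
have zgt2 : 2 < z by nra.
have s_ge2 : 2 < s by nra.
have s_gez : z / 2 <= s by nra.
(* From [s > 2], [s - 1 >= s / 2 >= z / 4]. *)
have zl : z * l <= 16 * p.+2%:R.
  apply: le_trans (_ : 4 * (s - 1) * l <= _); first by nra.
  rewrite mulrAC -ler_pdivlMr ?subr_gt0 //.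
  apply: le_trans (ler_wpM2l _ lp) _ => //.
  by rewrite le_eqVlt; apply/orP; left; apply/eqP; field; lra.
have p2 : p.+2%:R = p%:R + 2 :> R by rewrite -addn2 natrD.
have zl32 : z * l <= 32 * p%:R.
  have : 64 <= z * l by nra.
  by move: zl; rewrite p2; lra.
have m1 : 1 <= m%:R :> R by rewrite ler1n.
have chi6 : chi <= 6 * m%:R by move: chim; rewrite -[m.+1]addn1 natrD; lra.
have qR : p%:R * m%:R <= q%:R :> R by rewrite -natrM ler_nat.
have : chi * (z * l) <= 6 * m%:R * (32 * p%:R).
  by apply: ler_pM => //; [lra|rewrite mulr_ge0 //; lra].
lra.
Qed.
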